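(* Let $n\ge 1$, $k\ge 2$, $\mathbb{K}\in\{\mathbb{R},\mathbb{C}\}$, $\star\in\{H,T\}$, $\epsilon_1,\epsilon_2\in\{1,-1\}$, $\epsilon=\epsilon_1\epsilon_2$, and let $X\in\mathbb{K}^{n\times kn}$, $J\in\mathbb{K}^{kn\times kn}$. Then $(X,J)$ is a standard pair of a $(\star,\epsilon_1,\epsilon_2)$-structured matrix polynomial $P(\lambda)=\sum_{j=0}^k\lambda^jA_j$ over $\mathbb{K}$ with $A_k$ nonsingular if and only if $X_L$ is nonsingular and there exists a nonsingular matrix $\Gamma\in\mathcal{S}_{(J,\star,\epsilon_1,\epsilon_2)}$ such that $XJ^{k-1}\Gamma X^{\star}$ is nonsingular and $$XJ^r\Gamma X^{\star}=0,\qquad r=0,1,\ldots,k-2.\qquad (1)$$ In this case the coefficient matrices can be expressed as $$A_k=(XJ^{k-1}\Gamma X^{\star})^{-1},\qquad A_j=-\sum_{i=j+1}^kA_iXJ^{k-j+i-1}\Gamma X^{\star}A_k,\quad j=k-1,k-2,\ldots,0.\qquad (2)$$ Precisely: (a) if $(X,J)$ is a standard pair of such a $P(\lambda)$, then $X_L$ is nonsingular and there is a nonsingular $\Gamma\in\mathcal{S}_{(J,\star,\epsilon_1,\epsilon_2)}$ with $XJ^{k-1}\Gamma X^{\star}$ nonsingular for which (1) and (2) hold; (b) conversely, if $X_L$ is nonsingular and $\Gamma\in\mathcal{S}_{(J,\star,\epsilon_1,\epsilon_2)}$ is nonsingular with $XJ^{k-1}\Gamma X^{\star}$ nonsingular and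 (1) holds, then the matrices $A_0,\ldots,A_k$ defined by (2) are the coefficients of a $(\star,\epsilon_1,\epsilon_2)$-structured matrix polynomial, with $A_k$ nonsingular, having $(X,J)$ as a standard pair.
   Context: $A^H$ and $A^T$ denote the conjugate transpose and the transpose; $A^\star$ is whichever is selected by $\star$. A matrix polynomial $P(\lambda)=\sum_{j=0}^k\lambda^jA_j$ with $A_j\in\mathbb{K}^{n\times n}$ is $(\star,\epsilon_1,\epsilon_2)$-structured if $A_j^\star=\epsilon_1A_j$ for even $j$ and $A_j^\star=\epsilon_2A_j$ for odd $j$. For $X\in\mathbb{K}^{n\times kn}$, $J\in\mathbb{K}^{kn\times kn}$, let $X_L\in\mathbb{K}^{kn\times kn}$ be the matrix obtained by stacking $X,XJ,\ldots,XJ^{k-1}$ (top to bottom). The pair $(X,J)$ is a standard pair of $P(\lambda)$ if $X_L$ is nonsingular and $A_kXJ^k+A_{k-1}XJ^{k-1}+\cdots+A_1XJ+A_0X=0$. For $\Phi\in\mathbb{K}^{m\times m}$, $\mathcal{S}_{(\Phi,\star,\epsilon_1,\epsilon_2)}=\{S\in\mathbb{K}^{m\times m}: S^\star=\epsilon_2S,\ S\Phi^\star=\epsilon\,\Phi S\}$ with $\epsilon=\epsilon_1\epsilon_2$. *)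

(* Defs.v *)
From HB Require Import structures.
From mathcomp Require Import all_boot all_order all_algebra.
From mathcomp Require Import reals.
From mathcomp Require Import complex.

Set Implicit Arguments.
Unset Strict Implicit.
Unset Printing Implicit Defensive.

Import Order.TTheory GRing.Theory Num.Theory.
Local Open Scope ring_scope.
Local Open Scope complex_scope.

Variant base_field := RealField | ComplexField.

Definition scalars (R : realType) (b : base_field) : fieldType :=
  match b with RealField => R | ComplexField => R[i] end.

Definition sconj (R : realType) (b : base_field) :
    scalars R b -> scalars R b :=
  match b with RealField => id | ComplexField => fun z => z^* end.

Variant star_kind := StarH | StarT.

Definition starmx (R : realType) (b : base_field) (s : star_kind) (m n : nat)
    (A : 'M[scalars R b]_(m, n)) : 'M[scalars R b]_(n, m) :=
  match s with
  | StarH => map_mx (@sconj R b) A^T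
  | StarT => A^T
  end.

(* The matrix polynomial \sum_(j <= k) lambda^j A_j is given by its family of
   k + 1 coefficients; A ord_max is A_k, which is allowed to be zero. *)
Definition mxpolynomial (F : fieldType) (n k : nat) := 'I_k.+1 -> 'M[F]_n.

Definition structured (R : realType) (b : base_field) (s : star_kind)
    (e1 e2 : scalars R b) (n k : nat)
    (A : mxpolynomial (scalars R b) n k) : Prop :=
  forall j : 'I_k.+1,
    starmx s (A j) = (if odd j then e2 else e1) *: A j.

(* The stacked matrix has \sum_(i < k) n rows, which is only propositionally
   equal to k * n; the cast makes it square. *)
Lemma sum_block_size (n k : nat) : (\sum_(i < k) n = k * n)%N.
Proof. by rewrite sum_nat_const card_ord. Qed.

Definition stackmx (F : fieldType) (n k : nat)
    (X : 'M[F]_(n, k * n)) (J : 'M[F]_(k * n)) : 'M[F]_(k * n) :=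
  castmx (sum_block_size n k, erefl (k * n)%N)
    (\mxcol_(i < k) (X *m J ^+ i)).

Definition standard_pair (F : fieldType) (n k : nat)
    (X : 'M[F]_(n, k * n)) (J : 'M[F]_(k * n))
    (A : mxpolynomial F n k) : Prop :=
  stackmx X J \in unitmx /\ \sum_(j < k.+1) A j *m X *m J ^+ j = 0.

Definition in_Sset (R : realType) (b : base_field) (s : star_kind)
    (e1 e2 : scalars R b) (m : nat) (Phi S : 'M[scalars R b]_m) : Prop :=
  starmx s S = e2 *: S /\ S *m starmx s Phi = (e1 * e2) *: (Phi *m S).

Definition moment (R : realType) (b : base_field) (s : star_kind) (n k : nat)
    (X : 'M[scalars R b]_(n, k * n)) (J Gam : 'M[scalars R b]_(k * n))
    (r : nat) : 'M[scalars R b]_n :=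
  X *m J ^+ r *m Gam *m starmx s X.

Definition admissible (R : realType) (b : base_field) (s : star_kind)
    (e1 e2 : scalars R b) (n k : nat)
    (X : 'M[scalars R b]_(n, k * n)) (J Gam : 'M[scalars R b]_(k * n)) : Prop :=
  [/\ Gam \in unitmx, in_Sset s e1 e2 J Gam,
      moment s X J Gam k.-1 \in unitmx &
      forall r : nat, (r <= k - 2)%N -> moment s X J Gam r = 0].

(* For j < k the right-hand side only involves A_i with i > j, so this
   determines A recursively, downwards from A_k. *)
Definition coef_formula (R : realType) (b : base_field) (s : star_kind)
    (n k : nat)
    (X : 'M[scalars R b]_(n, k * n)) (J Gam : 'M[scalars R b]_(k * n))
    (A : mxpolynomial (scalars R b) n k) : Prop :=
  A ord_max = invmx (moment s X J Gam k.-1) /\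
  forall j : 'I_k.+1, (j < k)%N ->
    A j = - \sum_(i < k.+1 | (j < i)%N)
              A i *m moment s X J Gam (k - j + i - 1) *m A ord_max.

(* Main.v *)
(* Let P(lambda) = sum A_j lambda^j be structured with standard pair (X, J), let
   S be the block Hankel matrix [A_(i+j+1)] and D = diag((e1 e2)^i I).  Then
   Gamma = (X_L^star D S X_L)^(-1) works: S is block antitriangular, hence
   invertible, and S E_(k-1) = E_0 A_k for the block unit vectors E_i,
   which yields Gamma X^star = X_L^(-1) E_(k-1) A_k^(-1) and thus (1).  Given
   (1), formula (2) is equivalent to P(J) J^m Gamma X^star = 0 for all m < k,
   where P(J) = sum A_j X J^j.  Conversely J^m Gamma X^star equals, up to sign,
   Gamma (X J^m)^star, and the (X J^m)^star together span everything, so (2)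
   forces P(J) = 0. *)
Require Import Defs.
From HB Require Import structures.
From mathcomp Require Import all_boot all_order all_algebra.
From mathcomp Require Import reals.
From mathcomp Require Import complex.
From mathcomp Require Import zify ring.

Set Implicit Arguments.
Unset Strict Implicit.
Unset Printing Implicit Defensive.

Import Order.TTheory GRing.Theory Num.Theory.
Local Open Scope ring_scope.

(** Every case is the transpose followed by an entrywise involutive ring morphism, the identity or
    conjugation; the rules for [starmx] rest on this form, without case analysis. *)
Lemma starmxE (R : realType) (b : base_field) (s : star_kind) :
  exists2 f : {rmorphism scalars R b -> scalars R b}, involutive f &
    forall m n (A : 'M[scalars R b]_(m, n)), starmx s A = map_mx f A^T.
Proof.
case: s; last first.
  by exists idfun => // m n A; apply/matrixP => i j; rewrite !mxE.
case: b.
  by exists idfun => // m n A; apply/matrixP => i j; rewrite !mxE.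
by exists (@conjc R : {rmorphism R[i]%C -> R[i]%C}) => //; exact: conjcK.
Qed.

(** * Algebraic rules of the star *)

Section Starmx.
Variables (R : realType) (b : base_field) (s : star_kind).
Notation F := (scalars R b).

Lemma starmxK m n (A : 'M[F]_(m, n)) : starmx s (starmx s A) = A.
Proof.
have [f fK fE] := starmxE R b s.
by rewrite !fE; apply/matrixP => i j; rewrite !mxE.
Qed.

Lemma starmxM m n p (A : 'M[F]_(m, n)) (B : 'M[F]_(n, p)) :
  starmx s (A *m B) = starmx s B *m starmx s A.
Proof. by have [f fK fE] := starmxE R b s; rewrite !fE trmx_mul map_mxM. Qed.

Lemma starmxN m n (A : 'M[F]_(m, n)) : starmx s (- A) = - starmx s A.
Proof.
have [f fK fE] := starmxE R b s.
by rewrite !fE; apply/matrixP => i j; rewrite !mxE rmorphN.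
Qed.

Lemma starmx0 m n : starmx s (0 : 'M[F]_(m, n)) = 0.
Proof. by have [f fK fE] := starmxE R b s; rewrite !fE trmx0 map_mx0. Qed.

Lemma starmx_scalar n c : starmx s (c%:R%:M : 'M[F]_n) = c%:R%:M.
Proof.
have [f fK fE] := starmxE R b s.
by rewrite !fE tr_scalar_mx map_scalar_mx rmorph_nat.
Qed.

Lemma starmx1 n : starmx s (1%:M : 'M[F]_n) = 1%:M.
Proof. exact: (starmx_scalar n 1). Qed.

Lemma starmx_sum m n (I : Type) (r : seq I) (P : pred I)
    (A : I -> 'M[F]_(m, n)) :
  starmx s (\sum_(i <- r | P i) A i) = \sum_(i <- r | P i) starmx s (A i).
Proof.
have [f fK fE] := starmxE R b s; rewrite fE raddf_sum map_mx_sum /=.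
by apply: eq_bigr => i _; rewrite fE.
Qed.

Lemma starmxZ m n (e : F) (A : 'M[F]_(m, n)) :
  e = 1 \/ e = -1 -> starmx s (e *: A) = e *: starmx s A.
Proof. by case=> ->; rewrite ?scaleN1r ?starmxN ?scale1r. Qed.

End Starmx.

(** * Arithmetic of signs *)

Section Sign.
Variables (F : fieldType).

Lemma signM (x y : F) :
  x = 1 \/ x = -1 -> y = 1 \/ y = -1 -> x * y = 1 \/ x * y = -1.
Proof. by do 2![case=> ->]; rewrite ?mulrNN ?mul1r ?mulr1; auto. Qed.

Lemma signX (x : F) j : x = 1 \/ x = -1 -> x ^+ j = 1 \/ x ^+ j = -1.
Proof.
by move=> hx; elim: j => [|j IH]; [left | rewrite exprS; apply: signM].
Qed.

Lemma sign_sqr (x : F) : x = 1 \/ x = -1 -> x * x = 1.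
Proof. by case=> ->; rewrite ?mulrNN mul1r. Qed.

End Sign.

(* Z_0, ..., Z_(k-1) are the block columns of the inverse of X_L. *)
Definition dual_blocks (F : fieldType) (n k m : nat)
    (X : 'M[F]_(n, m)) (J : 'M[F]_m) (Z : nat -> 'M[F]_(m, n)) : Prop :=
  (forall i j, (i < k)%N -> (j < k)%N ->
     X *m J ^+ i *m Z j = (i == j)%:R%:M) /\
  \sum_(i < k) Z i *m (X *m J ^+ i) = 1%:M.

(** The sizes are variables so that the equality between them can be eliminated; in [stackmx] both
    are compound expressions. *)
Lemma castmx_rows_inv (F : fieldType) (p q : nat) (e : p = q)
    (L : 'M[F]_(p, q)) :
  castmx (e, erefl q) L \in unitmx ->
  exists2 V : 'M_(q, p), L *m V = 1%:M & V *m L = 1%:M.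
Proof.
case: q / e L => L; rewrite castmx_id => uL.
by exists (invmx L); rewrite ?mulmxV ?mulVmx.
Qed.

Lemma stackmx_dual_blocks (F : fieldType) (n k : nat)
    (X : 'M[F]_(n, k * n)) (J : 'M[F]_(k * n)) :
  stackmx X J \in unitmx -> exists Z, dual_blocks k X J Z.
Proof.
case/castmx_rows_inv => V; rewrite -[V]submxrowK => LV VL.
(* The value 0 for [j >= k] is a filler: [dual_blocks] reads only indices below [k]. *)
exists (fun j => if insub j is Some o then submxrow V o else 0); split.
  move=> i j ik jk; rewrite insubT.
  move: LV; rewrite mul_mxcol_mxrow -mxdiagZ /mxdiag => /eq_mxblockP.
  move=> /(_ (Ordinal ik) (Ordinal jk)) ->.
  rewrite /= conform_mx_id -val_eqE /=; case: eqP => // _.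
  by rewrite mulr0n raddf0.
move: VL; rewrite mul_mxrow_mxcol => VL; rewrite -[RHS]VL.
by apply: eq_bigr => i _; rewrite valK.
Qed.

(** * The Hankel form of a structured polynomial of degree [k = d + 1] *)

Section HankelForm.
Variables (R : realType) (b : base_field) (st : star_kind).
Notation F := (scalars R b).
Variables (n m d : nat) (e1 e2 : F) (X : 'M[F]_(n, m)) (J : 'M[F]_m).
Variables (a : nat -> 'M[F]_n) (Z : nat -> 'M[F]_(m, n)).
Hypotheses (he1 : e1 = 1 \/ e1 = -1) (he2 : e2 = 1 \/ e2 = -1).
Hypothesis a_star : forall j, (j <= d.+1)%N ->
  starmx st (a j) = (e1 * (e1 * e2) ^+ j) *: a j.
Hypothesis a_unit : a d.+1 \in unitmx.
Hypothesis a_XJ : \sum_(j < d.+2) a j *m X *m J ^+ j = 0.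
Hypothesis XJZ : dual_blocks d.+1 X J Z.

Let e := e1 * e2.

(* This is X_L^star D S X_L, with D the block diagonal matrix of the powers of
   e1 e2 and S the block Hankel matrix with blocks a_(i+j+1), summed along the
   antidiagonals i + j = s; its inverse is the required Gamma. *)
Definition hankel_form : 'M[F]_m :=
  \sum_(s < d.+1) \sum_(i < s.+1)
    (e1 * e2) ^+ i *:
      (starmx st (X *m J ^+ i) *m a s.+1 *m (X *m J ^+ (s - i))).

Let he : e = 1 \/ e = -1. Proof. exact: signM. Qed.

(** The star exchanges the terms [i] and [s - i] of an antidiagonal; the signs match because
    [e1 * e = e2] and [e ^+ 2 = 1]. *)
Lemma hankel_form_star : starmx st hankel_form = e2 *: hankel_form.
Proof.
rewrite starmx_sum scaler_sumr; apply: eq_bigr => s _.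
rewrite starmx_sum scaler_sumr (reindex_inj rev_ord_inj) /=.
apply: eq_bigr => i _; rewrite !subSS; have le_is : (i <= s)%N by rewrite -ltnS.
rewrite subKn // starmxZ; last exact: signX.
rewrite -[X in starmx st X]mulmxA starmxM starmxK starmxM a_star ?ltn_ord //.
rewrite !mulmxA -scalemxAr -!scalemxAl !scalerA -/e.
congr (_ *: _); transitivity (e1 * e * e ^+ (s - i) * e ^+ s).
  by rewrite exprSr; ring.
have -> : e ^+ s = e ^+ (s - i) * e ^+ i by rewrite -exprD subnK.
rewrite mulrA -[_ * _ * e ^+ (s - i)]mulrA.
rewrite sign_sqr ?mulr1; last exact: signX.
by rewrite /e mulrA sign_sqr // mul1r.
Qed.

Lemma hankel_form_comm : starmx st J *m hankel_form = e *: (hankel_form *m J).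
Proof.
(* Along the antidiagonal i + j = s + 1 of [B], the terms of [hankel_form *m J]
   miss only i = s + 1 and those of [starmx st J *m hankel_form] miss only
   i = 0, so the two differ by the sums of the first column and first row of
   [B], which vanish because of P(J) = 0. *)
pose B i j := e ^+ i *: (starmx st (X *m J ^+ i) *m a (i + j) *m (X *m J ^+ j)).
have B0j : \sum_(j < d.+2) B 0%N j = 0.
  rewrite -[RHS](mulmx0 _ (starmx st X)) -a_XJ mulmx_sumr.
  apply: eq_bigr => j _.
  by rewrite /B expr0 scale1r expr0 mulmx1 add0n !mulmxA.
(* Column 0 of [B] is [e1] times the star of row 0. *)
have Bi0 : \sum_(i < d.+2) B i 0%N = 0.
  transitivity (e1 *:
      starmx st (starmx st X *m \sum_(j < d.+2) a j *m X *m J ^+ j)).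
    rewrite mulmx_sumr starmx_sum scaler_sumr; apply: eq_bigr => i _.
    rewrite starmxM starmxK -(mulmxA (a i)) starmxM a_star ?leq_ord //.
    rewrite -scalemxAr -scalemxAl scalerA mulrA sign_sqr // mul1r.
    by rewrite /B addn0 expr0 mulmx1.
  by rewrite a_XJ mulmx0 starmx0 scaler0.
have GJ : hankel_form *m J = \sum_(s < d.+1) \sum_(i < s.+1) B i (s.+1 - i)%N.
  rewrite mulmx_suml; apply: eq_bigr => s _; rewrite mulmx_suml.
  apply: eq_bigr => i _; have le_is : (i <= s)%N by rewrite -ltnS.
  rewrite /B subnKC ?leqW // subSn // exprSr.
  by rewrite -scalemxAl -/e -!mulmxA.
have JG : starmx st J *m hankel_form =
    e *: \sum_(s < d.+1) \sum_(i < s.+1) B i.+1 (s - i)%N.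
  rewrite mulmx_sumr scaler_sumr; apply: eq_bigr => s _.
  rewrite mulmx_sumr scaler_sumr; apply: eq_bigr => i _.
  have le_is : (i <= s)%N by rewrite -ltnS.
  rewrite /B addSn subnKC // [J ^+ i.+1]exprSr (mulmxA X).
  rewrite (starmxM _ (X *m _) J).
  rewrite -scalemxAr scalerA.
  by rewrite exprS mulrA sign_sqr // mul1r !mulmxA.
rewrite JG GJ; congr (_ *: _); apply/eqP; rewrite -subr_eq0 -sumrB.
rewrite (eq_bigr (fun s : 'I_d.+1 => B s.+1 0%N - B 0%N s.+1)); last first.
  move=> s _; apply/eqP; rewrite subr_eq addrAC eq_sym subr_eq.
  rewrite addrC [X in _ == X]addrC; apply/eqP.
  transitivity (\sum_(i < s.+2) B i (s.+1 - i)%N).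
    by rewrite [RHS]big_ord_recr /= subnn.
  by rewrite [LHS]big_ord_recl /= subn0.
(* Adding the corner [B 0 0] completes both sums to the full column and the full row. *)
rewrite sumrB subr_eq0; apply/eqP; apply: (@addrI _ (B 0%N 0%N)).
transitivity (\sum_(i < d.+2) B i 0%N); first by rewrite [RHS]big_ord_recl.
by rewrite Bi0 -[LHS]B0j [LHS]big_ord_recl.
Qed.

(** The width of [w] is free so that [w] can be the cokernel matrix, which turns injectivity into
    invertibility. *)
Lemma hankel_form_inj p (w : 'M[F]_(m, p)) : hankel_form *m w = 0 -> w = 0.
Proof.
case: XJZ => XZ ZX Gw.
suff XJw q : (q < d.+1)%N -> X *m J ^+ q *m w = 0.
  rewrite -[w]mul1mx -ZX mulmx_suml big1 // => i _.
  by rewrite -mulmxA XJw ?mulmx0.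
(* S is block triangular: its row d - q involves only X J^j w with j <= q. *)
elim/ltn_ind: q => q IH lt_qd.
have row_p : a d.+1 *m (X *m J ^+ q *m w) = 0.
  have lt_pd : (d - q < d.+1)%N by lia.
  (* The star of [Z (d - q)] extracts block row [d - q]. On the last antidiagonal it leaves
     [a d.+1 *m X *m J ^+ q *m w]; the earlier ones vanish by induction. *)
  have := congr1 (mulmx (starmx st (Z (d - q)%N))) Gw.
  rewrite mulmx0 /hankel_form mulmx_suml mulmx_sumr big_ord_recr /= big1 ?add0r.
    rewrite mulmx_suml mulmx_sumr (bigD1 (Ordinal lt_pd)) //= big1 ?addr0.
      rewrite -scalemxAl -scalemxAr !mulmxA -starmxM XZ // eqxx starmx_scalar.
      rewrite mul1mx subKn // => /(congr1 (GRing.scale (e ^+ (d - q)))).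
      rewrite scaler0 scalerA sign_sqr ?scale1r -?mulmxA //; exact: signX.
    move=> i /negPf ne_i; rewrite -scalemxAl -scalemxAr !mulmxA -starmxM XZ //.
    by rewrite -[_ == _ :> nat]/(i == Ordinal lt_pd) ne_i starmx_scalar raddf0
      !mul0mx scaler0.
  move=> s _; rewrite mulmx_suml mulmx_sumr big1 // => i _.
  have lt_is := ltn_ord i; have lt_sd := ltn_ord s.
  rewrite -scalemxAl -scalemxAr.
  case: (eqVneq (i : nat) (d - q)%N) => [iE | ne_i].
    rewrite -(mulmxA _ _ w) IH ?mulmx0 ?scaler0 //; lia.
  rewrite !mulmxA -starmxM XZ ?(negPf ne_i) ?starmx_scalar ?raddf0 ?mul0mx
    ?scaler0 //; lia.
by rewrite -[LHS](mulKmx a_unit) row_p mulmx0.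
Qed.

Lemma hankel_form_unit : hankel_form \in unitmx.
Proof.
rewrite -row_full_unit -cokermx_eq0; apply/eqP.
by apply: hankel_form_inj; rewrite mulmx_coker.
Qed.

(** [X_L Z_d] is the last block unit vector, and the last block column of the Hankel matrix has a
    single nonzero block, [a d.+1] at the top. *)
Lemma hankel_form_last : hankel_form *m (Z d *m invmx (a d.+1)) = starmx st X.
Proof.
case: XJZ => XZ _.
have XJZd q : (q <= d)%N -> X *m J ^+ q *m (Z d *m invmx (a d.+1)) =
    (q == d)%:R *: invmx (a d.+1).
  by move=> le_qd; rewrite mulmxA XZ ?ltnS // mul_scalar_mx.
rewrite /hankel_form mulmx_suml big_ord_recr /= big1 ?add0r.
  rewrite mulmx_suml big_ord_recl /= big1 ?addr0.
    rewrite subn0 !expr0 scale1r mulmx1 -mulmxA XJZd // eqxx scale1r.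
    by rewrite -mulmxA mulmxV ?mulmx1.
  move=> i _; rewrite /bump /= -scalemxAl -mulmxA XJZd; last by lia.
  by rewrite ltn_eqF ?scale0r ?mulmx0 ?scaler0 //; have := ltn_ord i; lia.
move=> s _; rewrite mulmx_suml big1 // => i _.
have lt_is := ltn_ord i; have lt_sd := ltn_ord s.
rewrite -scalemxAl -mulmxA XJZd; last by lia.
by rewrite ltn_eqF ?scale0r ?mulmx0 ?scaler0 //; lia.
Qed.

End HankelForm.

(** A left and a right inverse of the same power series agree modulo [t^(K+1)]: compare the
    coefficients of [(a m) b = a (m b)]. Commutativity is not assumed, as the coefficients will be
    matrices. *)
Lemma truncated_inverse_uniq (S : nzRingType) (K : nat) (a m b : nat -> S) :
  (forall p, (p <= K)%N ->
     \sum_(i < p.+1) a i * m (p - i)%N = (p == 0%N)%:R) ->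
  (forall p, (p <= K)%N ->
     \sum_(i < p.+1) m i * b (p - i)%N = (p == 0%N)%:R) ->
  forall p, (p <= K)%N -> a p = b p.
Proof.
move=> am mb p le_pK.
pose P (f : nat -> S) := \poly_(i < K.+1) f i.
have coefP f g q : (q <= K)%N ->
    (P f * P g)`_q = \sum_(i < q.+1) f i * g (q - i)%N.
  move=> le_qK; rewrite coefM; apply: eq_bigr => i _.
  have lt_iq := ltn_ord i.
  by rewrite !coef_poly !ifT //; lia.
have amE : ((P a * P m) * P b)`_p = b p.
  rewrite coefM big_ord_recl coefP // am // mul1r subn0 coef_poly ltnS le_pK.
  rewrite big1 ?addr0 // => i _; have lt_ip := ltn_ord i.
  by rewrite coefP ?am ?mul0r //= /bump; lia.
have mbE : (P a * (P m * P b))`_p = a p.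
  rewrite coefM big_ord_recr /= subnn coefP // mb // mulr1 coef_poly ltnS le_pK.
  rewrite big1 ?add0r // => i _; have lt_ip := ltn_ord i.
  by rewrite coefP ?mb ?subn_eq0 1?leqNgt ?lt_ip ?mulr0 //; lia.
by rewrite -amE -mbE mulrA.
Qed.

(** * The coefficient recursion and its relation to [P(J) = 0] *)

Section Admissible.
Variables (R : realType) (b : base_field) (st : star_kind).
Notation F := (scalars R b).
Variables (n d : nat) (e1 e2 : F).
Hypotheses (he1 : e1 = 1 \/ e1 = -1) (he2 : e2 = 1 \/ e2 = -1).
Variables (X : 'M[F]_(n, d.+1 * n)) (J Gam : 'M[F]_(d.+1 * n)).

(** Trading parity for an exponent lets signs be combined by [exprD]. *)
Lemma structured_signE (j : nat) :
  (if odd j then e2 else e1) = e1 * (e1 * e2) ^+ j.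
Proof.
elim: j => [|j IH]; first by rewrite mulr1.
rewrite exprS mulrCA -IH /=; case: (odd j) => /=.
  by rewrite -mulrA sign_sqr // mulr1.
by rewrite mulrAC sign_sqr // mul1r.
Qed.

(** In the unrestricted sum, terms with [i < j] have moments of order below [d], hence vanish, and
    the term [i = j] is [A j] times the inverse of [A ord_max]; it remains to solve for [A j]. *)
Lemma coef_recursionE (A : mxpolynomial F n d.+1) (j : 'I_d.+2) :
  (forall r, (r < d)%N -> moment st X J Gam r = 0) ->
  moment st X J Gam d \in unitmx ->
  A ord_max = invmx (moment st X J Gam d) -> (j < d.+1)%N ->
  (A j = - \sum_(i < d.+2 | (j < i)%N)
           A i *m moment st X J Gam (d.+1 - j + i - 1) *m A ord_max) <->
  (\sum_(i < d.+2) A i *m moment st X J Gam (i + (d - j)) = 0).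
Proof.
move=> M0 uM AE lt_jd.
have -> : \sum_(i < d.+2) A i *m moment st X J Gam (i + (d - j)) =
    A j *m moment st X J Gam d + \sum_(i < d.+2 | (j < i)%N)
      A i *m moment st X J Gam (d.+1 - j + i - 1).
  rewrite (bigD1 j) //= subnKC; last by rewrite -ltnS.
  congr (_ + _).
  rewrite big_mkcond [RHS]big_mkcond; apply: eq_bigr => i _ /=.
  rewrite -(inj_eq val_inj); case: ltngtP => //= [lt_ji | lt_ij].
    by congr (_ *m moment _ _ _ _ _); lia.
  by rewrite M0 ?mulmx0 //; lia.
rewrite -mulmx_suml AE; set T := \sum_(i | _) _.
split=> [-> | /eqP]; first by rewrite mulNmx mulmxKV // addNr.
rewrite addr_eq0 => /eqP /(congr1 (mulmx^~ (invmx (moment st X J Gam d)))).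
by rewrite mulmxK // mulNmx.
Qed.

Lemma sum_moments (A : mxpolynomial F n d.+1) q :
  \sum_(i < d.+2) A i *m moment st X J Gam (i + q) =
  (\sum_(i < d.+2) A i *m X *m J ^+ i) *m (J ^+ q *m Gam *m starmx st X).
Proof.
rewrite mulmx_suml; apply: eq_bigr => i _.
by rewrite /moment exprD !mulmxA.
Qed.

Lemma standard_coef_formula (A : mxpolynomial F n d.+1) :
  (forall r, (r < d)%N -> moment st X J Gam r = 0) ->
  moment st X J Gam d \in unitmx ->
  A ord_max = invmx (moment st X J Gam d) ->
  \sum_(j < d.+2) A j *m X *m J ^+ j = 0 ->
  coef_formula st X J Gam A.
Proof.
move=> M0 uM AE AXJ; split=> // j lt_jd; apply/coef_recursionE => //.
by rewrite sum_moments AXJ mul0mx.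
Qed.

Section Converse.
Variable Z : nat -> 'M[F]_(d.+1 * n, n).
Hypothesis XJZ : dual_blocks d.+1 X J Z.
Hypothesis uGam : Gam \in unitmx.
Hypothesis Gam_S : in_Sset st e1 e2 J Gam.
Hypothesis M0 : forall r, (r < d)%N -> moment st X J Gam r = 0.
Hypothesis uM : moment st X J Gam d \in unitmx.

Lemma Sset_starX q :
  Gam *m starmx st (J ^+ q) = (e1 * e2) ^+ q *: (J ^+ q *m Gam).
Proof.
have [_ GamJ] := Gam_S.
elim: q => [|q IH].
  by rewrite (expr0 (e1 * e2)) (_ : J ^+ 0 = 1%:M) // starmx1 mulmx1 mul1mx
    scale1r.
rewrite [J ^+ _]exprS starmxM mulmxA IH -scalemxAl -mulmxA GamJ -scalemxAr.
by rewrite scalerA -exprSr mulmxA (commrX q (commr_refl J)).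
Qed.

(** The factor [e2] comes from the star of [Gam], the power of [e1 * e2] from moving [J ^+ r] across
    [Gam]. *)
Lemma moment_star r :
  starmx st (moment st X J Gam r) =
  (e2 * (e1 * e2) ^+ r) *: moment st X J Gam r.
Proof.
have [GamE _] := Gam_S.
rewrite /moment starmxM starmxK starmxM GamE starmxM -scalemxAl (mulmxA Gam).
by rewrite Sset_starX -scalemxAl -scalemxAr -scalemxAr scalerA !mulmxA.
Qed.

Lemma coef_formula_standard (A : mxpolynomial F n d.+1) :
  coef_formula st X J Gam A -> \sum_(j < d.+2) A j *m X *m J ^+ j = 0.
Proof.
move=> [AE Arec]; set P := (X in X = 0).
have PGam q : (q < d.+1)%N -> P *m Gam *m starmx st (X *m J ^+ q) = 0.
  move=> lt_qd; rewrite starmxM -mulmxA (mulmxA Gam) Sset_starX.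
  rewrite -scalemxAl -scalemxAr -sum_moments.
  (* The recursion at [j = d - q] is the one whose shift [d - j] equals [q]. *)
  have lt_dq : (d - q < d.+2)%N by lia.
  have := Arec (Ordinal lt_dq); rewrite coef_recursionE //=; last by lia.
  by rewrite subKn // => ->; [rewrite scaler0 | lia].
(* The identity is inserted as the star of [\sum_q Z q *m (X *m J ^+ q)], which reduces [P *m Gam]
   to the products in [PGam]. *)
rewrite -[P](mulmxK uGam) -[P *m Gam]mulmx1 -(@starmx1 _ _ st).
have [_ <-] := XJZ; rewrite starmx_sum mulmx_sumr big1 ?mul0mx // => q _.
by rewrite starmxM mulmxA PGam ?mul0mx.
Qed.

End Converse.

(** Instead of solving the recursion downwards, [- B *m X *m J ^+ d.+1] is expanded along the blocks
    [X *m J ^+ j] by means of the [Z j]. This makes [P(J) = 0] by construction, and (2) follows. *)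
Lemma coef_formula_exists Z :
  dual_blocks d.+1 X J Z ->
  (forall r, (r < d)%N -> moment st X J Gam r = 0) ->
  moment st X J Gam d \in unitmx ->
  exists A : mxpolynomial F n d.+1, coef_formula st X J Gam A.
Proof.
move=> [_ ZX] M0 uM; pose B := invmx (moment st X J Gam d).
exists (fun j => if j == d.+1 :> nat then B else - (B *m X *m J ^+ d.+1 *m Z j)).
apply: standard_coef_formula; rewrite ?eqxx //.
rewrite big_ord_recr /= eqxx -[X in _ + X]mulmx1 -ZX mulmx_sumr -big_split /=.
apply: big1 => j _; rewrite ltn_eqF // !mulNmx !mulmxA.
by rewrite addNr.
Qed.

End Admissible.

(* In the variable t = 1/lambda, formula (2) says that the reversed coefficients
   A_k, A_(k-1), ..., A_0 are the left inverse modulo t^(k+1) of the power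
   series with coefficients X J^(k-1+q) Gam X^star; applying star makes
   e1 (e1 e2)^j A_j^star the right inverse. *)
Lemma coef_formula_structured (R : realType) (b : base_field) (st : star_kind)
    (n d : nat) (e1 e2 : scalars R b)
    (X : 'M[scalars R b]_(n.+1, d.+1 * n.+1))
    (J Gam : 'M[scalars R b]_(d.+1 * n.+1))
    (A : mxpolynomial (scalars R b) n.+1 d.+1) :
  e1 = 1 \/ e1 = -1 -> e2 = 1 \/ e2 = -1 ->
  in_Sset st e1 e2 J Gam ->
  (forall r, (r < d)%N -> moment st X J Gam r = 0) ->
  moment st X J Gam d \in unitmx ->
  coef_formula st X J Gam A -> structured st e1 e2 A.
Proof.
move=> he1 he2 GamS M0 uM [AE Arec] j.
pose e := e1 * e2; have he : e = 1 \/ e = -1 by exact: signM.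
pose M q := moment st X J Gam (d + q).
pose a p := A (inord (d.+1 - p)).
pose c p := (e1 * e ^+ (d.+1 - p)) *: starmx st (a p).
have aM p : (p <= d.+1)%N ->
    \sum_(i < p.+1) a i *m M (p - i)%N = (p == 0%N)%:R%:M.
  case: p => [|p] le_pd.
    rewrite big_ord1 /a /M subn0 addn0 /= (_ : inord _ = ord_max).
      by rewrite AE mulVmx.
    by apply: val_inj; rewrite /= inordK.
  have lt_j : (d.+1 - p.+1 < d.+2)%N by lia.
  have := Arec (Ordinal lt_j); rewrite coef_recursionE //=; last by lia.
  move=> sum0; rewrite [RHS]raddf0 -[RHS]sum0; last by lia.
  rewrite [RHS](reindex_inj rev_ord_inj) /=.
  rewrite (big_ord_widen d.+2 (fun i => a i *m M (p.+1 - i)%N)) //.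
  rewrite big_mkcond; apply: eq_bigr => i _; have lt_i := ltn_ord i.
  (* For [i >= p + 2] the moment has order below [d]. *)
  case: ltnP => le_ip; last by rewrite M0 ?mulmx0 //; lia.
  rewrite (_ : (_ + (d - _) = d + (p.+1 - i))%N); last by lia.
  by congr (A _ *m _); apply: val_inj; rewrite /= inordK; lia.
have Mc p : (p <= d.+1)%N ->
    \sum_(i < p.+1) M i *m c (p - i)%N = (p == 0%N)%:R%:M.
  move=> le_pd.
  (* The factor [e ^+ p] is harmless: it is 1 for [p = 0], and the sum is zero otherwise. *)
  transitivity (e ^+ p *: starmx st (\sum_(i < p.+1) a i *m M (p - i)%N)).
    rewrite starmx_sum scaler_sumr (reindex_inj rev_ord_inj) /=.
    apply: eq_bigr => i _; have lt_i := ltn_ord i.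
    rewrite subSS subKn // starmxM (moment_star _ GamS).
    rewrite -scalemxAl -scalemxAr !scalerA; congr (_ *: _).
    have e2E : e2 = e1 * e by rewrite /e mulrA sign_sqr // mul1r.
    rewrite -/e {1}e2E -mulrA -exprS mulrCA.
    rewrite (_ : (d + (p - i)).+1 = (p + (d.+1 - i))%N); last by lia.
    rewrite exprD (mulrA (e ^+ p)) sign_sqr ?mul1r //; exact: signX.
  rewrite aM // starmx_scalar; case: p {le_pd} => [|p].
    by rewrite expr0 scale1r.
  by rewrite raddf0 scaler0.
have acE : a (d.+1 - j)%N = c (d.+1 - j)%N.
  apply: (@truncated_inverse_uniq _ d.+1 a M c); rewrite ?leq_subr // => p le_pd.
    exact: etrans (aM p le_pd) (rmorph_nat _ _).
  exact: etrans (Mc p le_pd) (rmorph_nat _ _).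
move: acE; rewrite /c /a subKn ?leq_ord // inord_val => {1}->.
rewrite structured_signE // starmxZ ?starmxK //.
by apply: signM => //; apply: signX.
Qed.

Theorem theorem2p2 (R : realType) (b : base_field) (s : star_kind)
    (n k : nat) (hn : (1 <= n)%N) (hk : (2 <= k)%N)
    (e1 e2 : scalars R b)
    (he1 : e1 = 1 \/ e1 = -1) (he2 : e2 = 1 \/ e2 = -1)
    (X : 'M[scalars R b]_(n, k * n)) (J : 'M[scalars R b]_(k * n)) :
  [/\ (exists A : mxpolynomial (scalars R b) n k,
         [/\ structured s e1 e2 A, A ord_max \in unitmx & standard_pair X J A])
      <->
      (stackmx X J \in unitmx /\
       exists Gam : 'M[scalars R b]_(k * n), admissible s e1 e2 X J Gam),
      (forall A : mxpolynomial (scalars R b) n k,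
         structured s e1 e2 A -> A ord_max \in unitmx ->
         standard_pair X J A ->
         stackmx X J \in unitmx /\
         exists Gam : 'M[scalars R b]_(k * n),
           admissible s e1 e2 X J Gam /\ coef_formula s X J Gam A)
    & (forall Gam : 'M[scalars R b]_(k * n),
         stackmx X J \in unitmx -> admissible s e1 e2 X J Gam ->
         (exists A : mxpolynomial (scalars R b) n k,
            coef_formula s X J Gam A) /\
         (forall A : mxpolynomial (scalars R b) n k,
            coef_formula s X J Gam A ->
            [/\ structured s e1 e2 A, A ord_max \in unitmx
              & standard_pair X J A]))].
Proof.
(* Making [n] a successor gives the nonzero ring of matrices required by the power series argument;
   [d = k - 1] is the last block index. *)
case: n hn X J => // n _; case: k hk => // d hd X J.
have forward (A : mxpolynomial (scalars R b) n.+1 d.+1) :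
    structured s e1 e2 A -> A ord_max \in unitmx -> standard_pair X J A ->
    stackmx X J \in unitmx /\
    exists Gam, admissible s e1 e2 X J Gam /\ coef_formula s X J Gam A.
  move=> strA uA [uX AXJ]; split=> //; have [Z XJZ] := stackmx_dual_blocks uX.
  pose a j := A (inord j).
  have aE (j : 'I_d.+2) : a j = A j by rewrite /a inord_val.
  have a_star j : (j <= d.+1)%N ->
      starmx s (a j) = (e1 * (e1 * e2) ^+ j) *: a j.
    by move=> le_jd; rewrite strA inordK // structured_signE.
  have a_max : a d.+1 = A ord_max by rewrite -aE.
  have a_unit : a d.+1 \in unitmx by rewrite a_max.
  have a_XJ : \sum_(j < d.+2) a j *m X *m J ^+ j = 0.
    by rewrite -[RHS]AXJ; apply: eq_bigr => j _; rewrite aE.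
  pose G := hankel_form s d e1 e2 X J a.
  have uG : G \in unitmx by apply: hankel_form_unit XJZ.
  (* Thus the moment of order [r] is [X *m J ^+ r *m Z d] times the inverse of [A ord_max], and
     duality yields (1). *)
  have GamX : invmx G *m starmx s X = Z d *m invmx (A ord_max).
    have <- : G *m (Z d *m invmx (a d.+1)) = starmx s X.
      exact: hankel_form_last.
    by rewrite mulKmx // a_max.
  have M_E r : (r <= d)%N ->
      moment s X J (invmx G) r = (r == d)%:R *: invmx (A ord_max).
    move=> le_rd; rewrite /moment -mulmxA GamX mulmxA XJZ.1 //.
    by rewrite mul_scalar_mx.
  have M0 r : (r < d)%N -> moment s X J (invmx G) r = 0.
    by move=> lt_rd; rewrite M_E 1?ltnW // ltn_eqF // scale0r.
  have Md : moment s X J (invmx G) d = invmx (A ord_max).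
    by rewrite M_E // eqxx scale1r.
  exists (invmx G); split; last first.
    by apply: standard_coef_formula; rewrite ?Md ?unitmx_inv ?invmxK.
  have Gstar : starmx s G = e2 *: G by apply: hankel_form_star.
  have JG : starmx s J *m G = (e1 * e2) *: (G *m J) by apply: hankel_form_comm.
  (* The bound [k >= 2] makes the truncated [k - 2] exact, so [r <= k - 2] means [r < d]. *)
  split; last by move=> r ?; apply: M0; lia.
  - by rewrite unitmx_inv.
  (* Both relations pass from [G] to its inverse by multiplying with [G]. *)
  - split.
      apply: (can_inj (mulKmx uG)).
      rewrite -scalemxAr mulmxV // -[LHS]scale1r -{1}(sign_sqr he2) -scalerA.
      by congr (_ *: _); rewrite scalemxAl -Gstar -starmxM mulVmx ?starmx1.
    rewrite -[LHS](mulmxK uG) -(mulmxA (invmx G)) JG.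
    by rewrite -scalemxAr mulKmx // -scalemxAl.
  - by rewrite Md unitmx_inv.
have backward (Gam : 'M[scalars R b]_(d.+1 * n.+1)) :
    stackmx X J \in unitmx -> admissible s e1 e2 X J Gam ->
    (exists A : mxpolynomial (scalars R b) n.+1 d.+1,
       coef_formula s X J Gam A) /\
    (forall A : mxpolynomial (scalars R b) n.+1 d.+1,
       coef_formula s X J Gam A ->
       [/\ structured s e1 e2 A, A ord_max \in unitmx & standard_pair X J A]).
  move=> uX [uGam GamS uM M0']; have [Z XJZ] := stackmx_dual_blocks uX.
  have M0 r : (r < d)%N -> moment s X J Gam r = 0.
    by move=> lt_rd; apply: M0'; lia.
  split=> [|A AF]; first exact: coef_formula_exists XJZ M0 uM.
  split; first exact: (coef_formula_structured he1 he2 GamS M0 uM AF).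
    by case: AF => ->; rewrite unitmx_inv.
  by split=> //; apply: (coef_formula_standard XJZ uGam GamS M0 uM AF).
split=> //; split=> [[A [strA uA AXJ]] | [uX [Gam GamA]]].
  by have [uX [Gam [GamA _]]] := forward A strA uA AXJ; split=> //; exists Gam.
by have [[A AF] /(_ A AF) ?] := backward Gam uX GamA; exists A.
Qed.
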